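(* Let $\phi$ be a nice permutation. If $\pi$ is any permutation containing an interval order-isomorphic to $\phi$, then $\mu[1,\pi]=0$; thus $\phi\in\mathcal{SZ}$.
   Context: Permutations of length $n$ are written in one-line notation $\pi=\pi_1\pi_2\cdots\pi_n$ (a bijection of $\{1,\dots,n\}$); $1$ denotes the permutation of length one and $\epsilon$ the empty permutation. Permutations are of length at least one, except that $\epsilon$ is included in closures as defined below. A permutation $\sigma$ is contained in $\pi$, written $\sigma\le\pi$, if some subsequence of $\pi$ (not necessarily of consecutive entries) is order-isomorphic to $\sigma$; this is a partial order. The Möbius function of the resulting poset of permutations of length at least one is defined recursively by $\mu[\sigma,\pi]=0$ if $\sigma\not\le\pi$, $\mu[\sigma,\sigma]=1$, and $\mu[\sigma,\pi]=-\sum_{\sigma\le\tau<\pi}\mu[\sigma,\tau]$ if $\sigma<\pi$. An interval of a permutation $\pi$ is a non-empty set of contiguous indices $i,i+1,\dots,j$ such that the set of values $\{\pi_i,\dots,\pi_j\}$ is also a set of contiguous integers; it is order-isomorphic to a permutation $\phi$ if the sequence $\pi_i\cdots\pi_j$ is order-isomorphic to $\phi$. $\mathcal{SZ}$ (the set of strongly zero permutations) is the set of all permutations $\phi$ such that every permutation $\pi$ containing an interval order-isomorphic to $\phi$ satisfies $\mu[1,\pi]=0$. The closure $\mathrm{Cl}(\alpha)$ of a permutation $\alpha$ is the set of all permutations contained in $\alpha$, including $\alpha$ itself and $\epsilon$. The cover $\mathrm{Cover}(\pi)$ is the set of permutations covered by $\pi$, i.e. of those $\sigma<\pi$ for which there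 is no $\tau$ with $\sigma<\tau<\pi$. For a set $L$ of permutations, the ground of $L$ is $\mathrm{Gr}(L)=\left(\bigcup_{\lambda\in L}\mathrm{Cl}(\lambda)\right)\setminus\mathcal{SZ}$. Let $\phi$ be a permutation and let $\psi\in\mathrm{Cover}(\phi)$. Then $\psi$ is a core of $\phi$ if $\mathrm{Gr}(\mathrm{Cover}(\phi)\setminus\{\psi\})\subseteq\mathrm{Cl}(\psi)$. A permutation $\phi$ is nice if $\mu[1,\phi]=0$ and $\phi$ has a core. *)

(* Defs.v *)
From HB Require Import structures.
From mathcomp Require Import all_boot all_order all_fingroup all_algebra.
From mathcomp Require Import boolp classical_sets.

Set Implicit Arguments.
Unset Strict Implicit.
Unset Printing Implicit Defensive.

Import Order.TTheory GRing.Theory.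

Local Open Scope nat_scope.

(* Positions and values are 0-based: the entry in position i of p, i < len p,
   is [entry p i].  The type contains the empty permutation, of length 0. *)
Definition permutation : Type := {n : nat & 'S_n}.

HB.instance Definition _ := Choice.on permutation.

Definition mkperm (n : nat) (s : 'S_n) : permutation :=
  Tagged (fun k : nat => 'S_k) s.

Definition len (p : permutation) : nat := tag p.

Definition entry (p : permutation) : 'S_(len p) := tagged p.

Definition nonempty_perm (p : permutation) : bool := 0 < len p.

Definition unit_perm : permutation := @mkperm 1 1%g.

Definition is_embedding (s p : permutation)
    (f : {ffun 'I_(len s) -> 'I_(len p)}) : bool :=
  [forall i : 'I_(len s), forall j : 'I_(len s), (i < j) ==> (f i < f j)] &&
  [forall i : 'I_(len s), forall j : 'I_(len s),
     (entry s i < entry s j) == (entry p (f i) < entry p (f j))].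

(* The subsequence of p in the positions I is order-isomorphic to s. *)
Definition order_iso_at (s p : permutation) (I : {set 'I_(len p)}) : bool :=
  [exists f : {ffun 'I_(len s) -> 'I_(len p)},
     is_embedding f && (I == [set f i | i : 'I_(len s)])].

Definition contained (s p : permutation) : bool :=
  [exists I : {set 'I_(len p)}, order_iso_at s I].

Lemma containedP (s p : permutation) :
  reflect (exists f : {ffun 'I_(len s) -> 'I_(len p)}, is_embedding f)
          (contained s p).
Proof.
apply: (iffP existsP) => [[I /existsP[f /andP[fE _]]]|[f fE]]; first by exists f.
by exists [set f i | i : 'I_(len s)]; apply/existsP; exists f; rewrite fE eqxx.
Qed.

Lemma embeddingP (s p : permutation) (f : {ffun 'I_(len s) -> 'I_(len p)}) :
  reflect ((forall i j : 'I_(len s), i < j -> f i < f j) /\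
           (forall i j : 'I_(len s), (entry s i < entry s j) =
                        (entry p (f i) < entry p (f j))))
          (is_embedding f).
Proof.
apply: (iffP andP) => -[f1 f2]; split.
- by move=> i j; move/forallP: f1 => /(_ i)/forallP/(_ j)/implyP.
- by move=> i j; move/forallP: f2 => /(_ i)/forallP/(_ j)/eqP.
- by apply/forallP => i; apply/forallP => j; apply/implyP; apply: f1.
- by apply/forallP => i; apply/forallP => j; apply/eqP; apply: f2.
Qed.

Lemma increasing_inj (m n : nat) (f : 'I_m -> 'I_n) :
  (forall i j : 'I_m, i < j -> f i < f j) -> injective f.
Proof.
move=> finc i j fij; apply: val_inj; case: (ltngtP i j) => // /finc;
  by rewrite fij ltnn.
Qed.

Lemma increasing_id (n : nat) (f : 'I_n -> 'I_n) :
  (forall i j : 'I_n, i < j -> f i < f j) -> f =1 id.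
Proof.
have ge_id (g : 'I_n -> 'I_n) : (forall i j : 'I_n, i < j -> g i < g j) ->
    forall i : 'I_n, i <= g i.
  move=> ginc [k]; elim: k => [|k IH] ltkn //=.
  apply: leq_ltn_trans (IH (ltnW ltkn)) _.
  by apply: ginc.
move=> finc i; apply/val_inj/eqP; rewrite eqn_leq (ge_id f finc) andbT.
have rinc (k l : 'I_n) :
    k < l -> rev_ord (f (rev_ord k)) < rev_ord (f (rev_ord l)).
  have rev_lt (x y : 'I_n) : x < y -> rev_ord y < rev_ord x.
    move=> ltxy; have ltSxy : x.+1 < y.+1 by rewrite ltnS.
    exact: ltn_sub2l (leq_ltn_trans ltxy (ltn_ord y)) ltSxy.
  by move=> ltkl; apply/rev_lt/finc/rev_lt.
have := ge_id (fun k => rev_ord (f (rev_ord k))) rinc (rev_ord i).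
rewrite rev_ordK /= => le_ni; rewrite leqNgt; apply/negP => lt_if.
have lt_ifS : i.+1 < (f i).+1 by rewrite ltnS.
have := ltn_sub2l (leq_ltn_trans lt_if (ltn_ord (f i))) lt_ifS.
by rewrite ltnNge le_ni.
Qed.

Lemma contained_len (s p : permutation) : contained s p -> len s <= len p.
Proof.
move=> /containedP[f /embeddingP[finc _]].
by have := leq_card f (increasing_inj finc); rewrite !card_ord.
Qed.

Lemma contained_refl : reflexive contained.
Proof.
move=> p; apply/containedP; exists [ffun i => i]; apply/embeddingP.
by split=> i j; rewrite !ffunE.
Qed.

Lemma contained_trans : transitive contained.
Proof.
move=> q s p /containedP[f /embeddingP[f1 f2]] /containedP[g /embeddingP[g1 g2]].
apply/containedP; exists [ffun i => g (f i)]; apply/embeddingP.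
split=> i j; rewrite !ffunE; first by move=> /f1/g1.
by rewrite f2 g2.
Qed.

Lemma contained_eq (s p : permutation) :
  contained s p -> len p <= len s -> s = p.
Proof.
move=> /[dup] /contained_len le_sp sp le_ps.
case: s p sp le_sp le_ps => [m s] [n p]; rewrite /len /= => sp le_mn le_nm.
have emn : m = n by apply/eqP; rewrite eqn_leq le_mn.
subst m => {le_mn le_nm}.
case/containedP: sp => f /embeddingP[/increasing_id fid fE].
suff -> : s = p by [].
have fE' (k l : 'I_n) : (s k < s l) = (p k < p l).
  by have := fE k l; rewrite !fid.
have spE : (fun i : 'I_n => p (s^-1%g i)) =1 id.
  by apply: increasing_id => k l ltkl; rewrite -fE' !permKV.
by apply/permP => i; have := spE (s i); rewrite /= permK => ->.
Qed.

Lemma contained_anti : antisymmetric contained.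
Proof. by move=> s p /andP[sp /contained_len /(contained_eq sp)]. Qed.

Fact containment_display : Order.disp_t.
Proof. exact: Order.Disp tt tt. Qed.

HB.instance Definition _ := Order.Le_isPOrder.Build containment_display
  permutation contained_refl contained_anti contained_trans.

Lemma lt_len (s p : permutation) : (s < p)%O -> len s < len p.
Proof.
rewrite lt_neqAle => /andP[nsp sp]; rewrite ltnNge.
by apply: contraNN nsp => /(contained_eq sp) ->.
Qed.

(* The sum ranges over all t with s <= t < p, by lt_len.  The recursion is on a
   strict bound k for the length of p; see mobiusE below.
   When s is not empty, no t in the sum is empty, so [mobius s] is the Moebius
   function of the poset of permutations of length at least one. *)
Fixpoint mobius_rec (k : nat) (s p : permutation) : int :=
  if k is k'.+1 then
    if ~~ (s <= p)%O then 0%R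
    else if s == p then 1%R
    else (- \sum_(n < len p)
             \sum_(t : 'S_n | (s <= mkperm t)%O && (mkperm t < p)%O)
               mobius_rec k' s (mkperm t))%R
  else 0%R.

Definition mobius (s p : permutation) : int := mobius_rec (len p).+1 s p.

Lemma mobius_rec_stable (k l : nat) (s p : permutation) :
  len p < k -> len p < l -> mobius_rec k s p = mobius_rec l s p.
Proof.
elim: k l p => [|k IH] [|l] p //= pk pl.
case: ifP => // _; case: ifP => // _; congr (- _)%R.
apply: eq_bigr => n _; apply: eq_bigr => t _.
by apply: IH; apply: leq_trans (ltn_ord n) _.
Qed.

Lemma mobiusE (s p : permutation) :
  mobius s p =
    (if ~~ (s <= p)%O then 0
     else if s == p then 1
     else - \sum_(n < len p)
              \sum_(t : 'S_n | (s <= mkperm t)%O && (mkperm t < p)%O)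
                mobius s (mkperm t))%R.
Proof.
rewrite {1}/mobius /=; case: ifP => // _; case: ifP => // _; congr (- _)%R.
apply: eq_bigr => n _; apply: eq_bigr => t _.
by apply: mobius_rec_stable => //; apply: ltn_ord.
Qed.

Definition contiguous (n : nat) (A : {set 'I_n}) : bool :=
  [exists a : 'I_n, exists b : 'I_n,
     (a <= b) && (A == [set k : 'I_n | a <= k <= b]%SET)].

Definition is_interval (p : permutation) (I : {set 'I_(len p)}) : bool :=
  contiguous I && contiguous [set entry p i | i in I].

Definition has_interval_copy (phi p : permutation) : bool :=
  [exists I : {set 'I_(len p)}, is_interval I && order_iso_at phi I].

Local Open Scope classical_set_scope.

(* Intervals are not empty, so p below has length at least one; for the empty
   phi the condition on p would hold vacuously. *)
Definition SZ : set permutation :=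
  [set phi | nonempty_perm phi /\
     forall p : permutation, has_interval_copy phi p -> mobius unit_perm p = 0%R].

Definition Cl (a : permutation) : set permutation := [set s | (s <= a)%O].

Definition Cover (p : permutation) : set permutation :=
  [set s | [/\ nonempty_perm s, (s < p)%O &
     ~ exists t : permutation, (s < t)%O /\ (t < p)%O]].

Definition Gr (L : set permutation) : set permutation :=
  (\bigcup_(l in L) Cl l) `\` SZ.

Definition is_core (phi psi : permutation) : Prop :=
  Cover phi psi /\ Gr (Cover phi `\ psi) `<=` Cl psi.

Definition nice (phi : permutation) : Prop :=
  mobius unit_perm phi = 0%R /\ exists psi : permutation, is_core phi psi.

(* Main.v *)
Require Import Defs.
From mathcomp Require Import all_boot all_order all_fingroup all_algebra.
From mathcomp Require Import boolp classical_sets.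

(** Let psi be a core of phi and let phi occur in p on an interval I.  If p is
    not phi itself, let q be p with the entries in I thinned out to a copy of
    psi; then 1 < q < p, so the values mu[1,t] for t <= q add up to 0.  It
    remains to see that mu[1,t] = 0 whenever t < p but not t <= q.  The part of
    t that an embedding into p sends into I is an interval of t, of some shape
    s <= phi.  If s = phi, induct on the length of p.  Otherwise s is contained
    in a cover of phi but not in psi (else t <= q), so s is strongly zero by the
    definition of a core. *)

Set Implicit Arguments.
Unset Strict Implicit.
Unset Printing Implicit Defensive.

Import Order.TTheory GRing.Theory.

Local Open Scope nat_scope.

(** * Embeddings, and the pattern of a set of positions *)

Definition embeds (s p : permutation) (f : 'I_(len s) -> 'I_(len p)) : Prop :=
  (forall i j, (f i < f j) = (i < j)) /\
  (forall i j, (entry p (f i) < entry p (f j)) = (entry s i < entry s j)).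

(** Trichotomy turns the implication on positions into an equation, so that both orders can be
    rewritten in either direction. *)
Lemma is_embedding_embeds (s p : permutation)
    (f : {ffun 'I_(len s) -> 'I_(len p)}) : is_embedding f <-> embeds f.
Proof.
split=> [/embeddingP[f1 f2]|[f1 f2]]; last first.
  by apply/embeddingP; split=> i j; rewrite ?f1 ?f2.
split=> i j; last by rewrite f2.
by case: (ltngtP i j) => [/f1|/f1|/val_inj ->]; rewrite ?ltnn // => /ltnW;
  rewrite leqNgt => /negbTE.
Qed.

Lemma contained_embeds (s p : permutation) :
  contained s p <-> exists f : 'I_(len s) -> 'I_(len p), embeds f.
Proof.
split=> [/containedP[f /is_embedding_embeds fE]|[f [f1 f2]]]; first by exists f.
apply/containedP; exists [ffun i => f i]; apply/is_embedding_embeds.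
by split=> i j; rewrite !ffunE.
Qed.

Lemma order_iso_at_embeds (s p : permutation) (I : {set 'I_(len p)}) :
  order_iso_at s I <->
  exists f : 'I_(len s) -> 'I_(len p),
    embeds f /\ I = [set f i | i in 'I_(len s)]%SET.
Proof.
split=> [/existsP[f /andP[/is_embedding_embeds fE /eqP ->]]|[f [[f1 f2] ->]]].
  by exists f.
apply/existsP; exists [ffun i => f i]; apply/andP; split.
  by apply/is_embedding_embeds; split=> i j; rewrite !ffunE.
by apply/eqP/eq_imset => i; rewrite ffunE.
Qed.

Lemma embeds_inj (s p : permutation) (f : 'I_(len s) -> 'I_(len p)) :
  embeds f -> injective f.
Proof. by move=> [f1 _]; apply: increasing_inj => i j; rewrite f1. Qed.

Lemma embeds_comp (q s p : permutation) (f : 'I_(len s) -> 'I_(len p))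
    (g : 'I_(len q) -> 'I_(len s)) : embeds f -> embeds g -> embeds (f \o g).
Proof. by move=> [f1 f2] [g1 g2]; split=> i j /=; rewrite ?f1 ?f2 ?g1 ?g2. Qed.

(** Since [g] reflects both orders, choosing a preimage under [g] of each [f i] yields an
    embedding. *)
Lemma embeds_factor (q s p : permutation) (f : 'I_(len q) -> 'I_(len p))
    (g : 'I_(len s) -> 'I_(len p)) :
  embeds f -> embeds g -> (forall i, exists j, f i = g j) -> contained q s.
Proof.
move=> [f1 f2] [g1 g2] /choice[e fE]; apply/contained_embeds; exists e.
by split=> i j; [rewrite -g1 -!fE f1|rewrite -g2 -!fE f2].
Qed.

Lemma enum_val_mono (n : nat) (A : {set 'I_n}) (i j : 'I_#|A|) :
  (enum_val i < enum_val j) = (i < j).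
Proof.
have inc (k l : 'I_#|A|) : k < l -> enum_val k < enum_val l.
  move=> ltkl; pose x0 := enum_val k.
  (* [enum A] is a filtered [enum 'I_n], hence increasing. *)
  have srt : sorted ltn [seq val x | x <- enum A].
    apply: (subseq_sorted ltn_trans (s2 := [seq val x | x <- enum 'I_n])).
      by apply: map_subseq; rewrite !enumT; apply: filter_subseq.
    by rewrite val_enum_ord iota_ltn_sorted.
  have := sorted_ltn_nth ltn_trans 0 srt k l.
  rewrite !inE size_map -cardE !ltn_ord => /(_ isT isT ltkl).
  by rewrite !(nth_map x0) -?cardE // -!enum_val_nth.
by case: (ltngtP i j) => [/inc|/inc|/val_inj ->]; rewrite ?ltnn // => /ltnW;
  rewrite leqNgt => /negbTE.
Qed.

(* Standardization: the rank of a value is the number of smaller ones. *)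
Lemma injective_standardize (n m : nat) (v : 'I_n -> 'I_m) : injective v ->
  exists s : 'S_n, forall i j, (s i < s j) = (v i < v j).
Proof.
move=> vI; pose r i := #|[set k | v k < v i]%SET|.
have rlt i : r i < n.
  rewrite -[X in _ < X]card_ord; apply: proper_card; apply/properP; split.
    exact: subset_predT.
  by exists i; rewrite // inE ltnn.
have rinc i j : v i < v j -> r i < r j.
  move=> ltij; apply: proper_card; apply/properP; split.
    by apply/fintype.subsetP => k; rewrite !inE => /ltn_trans; apply.
  by exists i; rewrite inE ?ltnn.
have rE i j : (r i < r j) = (v i < v j).
  by case: (ltngtP (v i) (v j)) => [/rinc|/rinc|/val_inj/vI ->];
    rewrite ?ltnn // => /ltnW; rewrite leqNgt => /negbTE.
have rI : injective (fun i => Ordinal (rlt i)).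
  move=> i j /(congr1 val) /= rij; apply/vI/val_inj.
  by case: (ltngtP (v i) (v j)) => // /rinc; rewrite rij ltnn.
by exists (perm rI) => i j; rewrite !permE rE.
Qed.

Lemma pattern_exists (p : permutation) (A : {set 'I_(len p)}) :
  exists s : permutation, len s = #|A| /\ exists f : 'I_(len s) -> 'I_(len p),
    embeds f /\ A = [set f i | i in 'I_(len s)]%SET.
Proof.
have [|s sE] := @injective_standardize _ _ (fun i => entry p (@enum_val _ (mem A) i)).
  by move=> i j /perm_inj/enum_val_inj.
exists (mkperm s); split=> //; exists (@enum_val _ (mem A)); split.
  by split=> i j; [rewrite enum_val_mono|rewrite -sE].
apply/setP => x; apply/idP/imsetP => [xA|[i _ ->]]; last exact: enum_valP.
by exists (enum_rank_in xA x); rewrite ?enum_rankK_in.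
Qed.

(** * Contiguous sets and intervals *)

Lemma contiguousP (n : nat) (A : {set 'I_n}) :
  contiguous A <-> (exists x, x \in A) /\
    (forall x y z : 'I_n, x \in A -> z \in A -> x <= y <= z -> y \in A).
Proof.
split=> [/existsP[a /existsP[b /andP[leab /eqP ->]]]|[[x0 x0A] conv]].
  split; first by exists a; rewrite inE leqnn.
  move=> x y z; rewrite !inE => /andP[ax _] /andP[_ zb] /andP[xy yz].
  by rewrite (leq_trans ax xy) (leq_trans yz zb).
(* The endpoints are the least and the greatest element of [A]. *)
case: (arg_minnP val x0A) => a aA amin; case: (arg_maxnP val x0A) => b bA bmax.
apply/existsP; exists a; apply/existsP; exists b; rewrite (amin _ bA) /=.
apply/eqP/setP => k; rewrite inE; apply/idP/idP => [kA|]; last exact: conv.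
by rewrite (amin _ kA) (bmax _ kA : k <= b).
Qed.

(** By convexity, a point outside [A] has all of [A] on one side. *)
Lemma contiguous_outside (n : nat) (A : {set 'I_n}) (x y z : 'I_n) :
  contiguous A -> x \notin A -> y \in A -> z \in A ->
  (x < y) = (x < z) /\ (y < x) = (z < x).
Proof.
move=> /contiguousP[_ conv] xA yA zA.
have nconv u v : u \in A -> v \in A -> ~~ (u <= x <= v).
  by move=> uA vA; apply: contra xA; apply: conv.
have nxy : val x != val y by apply: contraNneq xA => /val_inj ->.
have nxz : val x != val z by apply: contraNneq xA => /val_inj ->.
move: (nconv y z yA zA) (nconv z y zA yA) nxy nxz => /=.
by case: (ltngtP x y) => //; case: (ltngtP x z).
Qed.

Lemma preim_interval (s p : permutation) (f : 'I_(len s) -> 'I_(len p))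
    (I : {set 'I_(len p)}) (i0 : 'I_(len s)) :
  embeds f -> is_interval I -> f i0 \in I -> is_interval (f @^-1: I).
Proof.
move=> [f1 f2] /andP[/contiguousP[_ c1] /contiguousP[_ c2]] fi0.
have f1' i j : (f i <= f j) = (i <= j) by rewrite leqNgt f1 -leqNgt.
have f2' i j : (entry p (f i) <= entry p (f j)) = (entry s i <= entry s j).
  by rewrite leqNgt f2 -leqNgt.
apply/andP; split; apply/contiguousP; split.
- by exists i0; rewrite inE.
- by move=> x y z; rewrite !inE => fx fz xyz; apply: c1 fx fz _; rewrite !f1'.
- by exists (entry s i0); apply: imset_f; rewrite inE.
- move=> _ y _ /imsetP[i iI ->] /imsetP[k kI ->] ikE.
  (* The value [y] occurs in [s] at some position [j]; the value of [p] at [f j] lies between two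
     values of [I], so [f j] is in [I]. *)
  rewrite -[y](permKV (entry s)); apply: imset_f; rewrite inE.
  set j := (_ y); rewrite -(mem_imset _ _ (@perm_inj _ (entry p))).
  rewrite inE in iI; rewrite inE in kI.
  apply: c2 (imset_f _ iI) (imset_f _ kI) _.
  by rewrite !f2' /j !permKV.
Qed.

(** Only the entries that [f] sends into [I] are moved, and they stay in [I]. An entry outside
    compares in the same way with every point of [I], in position and in value, so no comparison
    changes. *)
Lemma embeds_reroute (q s p : permutation) (I : {set 'I_(len p)})
    (f : 'I_(len q) -> 'I_(len p)) (t : 'I_(len s) -> 'I_(len q))
    (k : 'I_(len s) -> 'I_(len p)) :
  is_interval I -> embeds f -> embeds t -> embeds k ->
  (f @^-1: I = [set t j | j in 'I_(len s)])%SET -> (forall j, k j \in I) ->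
  exists f' : 'I_(len q) -> 'I_(len p), embeds f' /\
    forall i, f' i \notin I \/ exists j, f' i = k j.
Proof.
move=> /andP[cI cV] [f1 f2] [t1 t2] [k1 k2] tJ kI.
pose V := [set entry p i | i in I]%SET.
pose f' i := if [pick j | t j == i] is Some j then k j else f i.
have fE i : (exists2 j, i = t j & f' i = k j) \/ (f i \notin I /\ f' i = f i).
  rewrite /f'; case: pickP => [j /eqP <-|nt]; first by left; exists j.
  right; split=> //; apply/negP => fi.
  have : i \in (f @^-1: I)%SET by rewrite inE.
  by rewrite tJ => /imsetP[j _ ij]; have := nt j; rewrite ij eqxx.
have ftI j : f (t j) \in I.
  have : t j \in (f @^-1: I)%SET by rewrite tJ imset_f.
  by rewrite inE.
have inV x : (entry p x \in V) = (x \in I) by rewrite mem_imset //; apply: perm_inj.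
exists f'; split; last first.
  by move=> i; case: (fE i) => [[j _ ->]|[fi ->]]; [right; exists j|left].
(* Four cases: each of [i] and [j] is either moved or kept. *)
split=> i j; case: (fE i) => [[i' -> ->]|[fi ->]];
    case: (fE j) => [[j' -> ->]|[fj ->]].
- by rewrite k1 t1.
- by rewrite -f1; case: (contiguous_outside cI fj (kI i') (ftI i')).
- by rewrite -f1; case: (contiguous_outside cI fi (kI j') (ftI j')).
- exact: f1.
- by rewrite k2 t2.
- rewrite -f2; move: (kI i') (ftI i') fj; rewrite -!inV => a b c.
  by case: (contiguous_outside cV c a b).
- rewrite -f2; move: (kI j') (ftI j') fi; rewrite -!inV => a b c.
  by case: (contiguous_outside cV c a b).
- exact: f2.
Qed.

(** * Covers and sums of the Möbius function *)

Lemma unit_le (p : permutation) : nonempty_perm p -> (unit_perm <= p)%O.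
Proof.
move=> p0; apply/contained_embeds; exists (fun=> Ordinal p0).
by split=> i j; rewrite ltnn !(ord1 i) !(ord1 j) ltnn.
Qed.

Lemma below_cover (s p : permutation) : nonempty_perm s -> (s < p)%O ->
  exists2 c, Cover p c & (s <= c)%O.
Proof.
(* Induction on a bound for the length gap, which shrinks when [s] is replaced by a permutation
   strictly between. *)
move: {-1}(len p - len s) (leqnn (len p - len s)) => n.
elim: n s => [|n IH] s.
  by rewrite leqn0 subn_eq0 leqNgt => /negbTE le_ps _ /lt_len; rewrite le_ps.
move=> le_n s0 sp.
have [[t [st tp]]|nt] := pselect (exists t, (s < t)%O /\ (t < p)%O); last by exists s.
have [||//|c cp tc] := IH t.
- by rewrite -ltnS; apply: leq_trans le_n; apply: ltn_sub2l; exact: lt_len.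
- exact: leq_trans s0 (ltnW (lt_len st)).
- by exists c => //; apply: ltW (lt_le_trans st tc).
Qed.

(** This is the recursion for [mobius s q] with its own term moved into the sum. Lengths above
    [len q] contribute nothing, so [N] is free and can later be the length of a larger
    permutation. *)
Lemma sum_mobius_le (s q : permutation) (N : nat) :
  (s < q)%O -> len q < N ->
  (\sum_(n < N) \sum_(t : 'S_n | (s <= mkperm t)%O && (mkperm t <= q)%O)
     mobius s (mkperm t) = 0)%R.
Proof.
move=> sq qN; pose F n := (\sum_(t : 'S_n | (s <= mkperm t)%O && (mkperm t <= q)%O)
     mobius s (mkperm t))%R.
rewrite -(big_mkord xpredT F) (@big_cat_nat _ _ _ (len q).+1) //=.
rewrite [X in (_ + X)%R]big_nat_cond [X in (_ + X)%R]big1 ?addr0; last first.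
  move=> n /andP[/andP[ltqn _] _]; apply: big1 => t /andP[_ /contained_len].
  by rewrite /len /= leqNgt ltqn.
rewrite big_mkord big_ord_recr /=.
(* The only permutation below [q] of the same length is [q]. *)
have -> : F (len q) = mobius s q.
  case: q sq qN @F => n q sq qN F; rewrite /F /len /= (big_pred1 q) // => t /=.
  apply/andP/eqP => [[_ tq]|->]; last by split; [exact: ltW|].
  have /eqP := contained_eq tq (leqnn _).
  by rewrite -tag_eqE /tag_eq eqxx tagged_asE => /eqP.
rewrite mobiusE (ltW sq) (lt_eqF sq) /=.
apply/eqP; rewrite subr_eq0; apply/eqP; apply: eq_bigr => n _.
apply: eq_bigl => t; congr (_ && _); rewrite le_eqVlt.
suff /negbTE -> : mkperm t != q by [].
by apply: contraTneq (ltn_ord n) => tq; rewrite -[in X in _ < X]tq ltnn.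
Qed.

(** In the recursion for [mobius s p], the terms with [t <= q] cancel by [sum_mobius_le], and the
    others vanish one by one. *)
Lemma mobius_eq0 (s p q : permutation) : (s < q)%O -> (q < p)%O ->
  (forall t, (s <= t)%O -> (t < p)%O -> ~~ (t <= q)%O -> mobius s t = 0%R) ->
  mobius s p = 0%R.
Proof.
move=> sq qp t0; have sp := lt_trans sq qp.
rewrite mobiusE (ltW sp) (lt_eqF sp) /=.
apply/eqP; rewrite oppr_eq0; apply/eqP.
rewrite -[RHS](sum_mobius_le sq (lt_len qp)).
apply: eq_bigr => n _.
rewrite (bigID (fun t : 'S_n => (mkperm t <= q)%O)) /=.
rewrite [X in (_ + X)%R]big1 ?addr0; last first.
  by move=> t /andP[/andP[st tp] tq]; apply: t0.
apply: eq_bigl => t; rewrite -andbA; congr (_ && _).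
by rewrite andb_idl // => /le_lt_trans; apply.
Qed.

(** * Permutations with a core *)

Section Core.

Variables phi psi : permutation.
Hypothesis core : is_core phi psi.

Lemma core_SZ (s : permutation) :
  nonempty_perm s -> (s < phi)%O -> ~~ (s <= psi)%O -> SZ s.
Proof.
move=> s0 sphi nspsi; have [c cphi sc] := below_cover s0 sphi.
apply: contrapT => nSZ; apply: (negP nspsi); apply: (core.2 s).
(* The cover [c] above [s] is not [psi], so [s] would lie in the ground. *)
split=> //; exists c => //; split=> //= cpsi.
by apply: (negP nspsi); rewrite -cpsi.
Qed.

Lemma core_interval (p : permutation) :
  p <> phi -> has_interval_copy phi p ->
  (forall t, (t < p)%O -> has_interval_copy phi t -> mobius unit_perm t = 0%R) ->
  mobius unit_perm p = 0%R.
Proof.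
move=> np /existsP[I /andP[intI /order_iso_at_embeds[g [gE gI]]]] IH.
have [[psi0 psi_phi _] _] := core.
have [h hE] : exists h : 'I_(len psi) -> 'I_(len phi), embeds h.
  by apply/contained_embeds; apply: (ltW psi_phi).
have gIin i : g i \in I by rewrite gI imset_f.
have phi_p : (phi < p)%O.
  rewrite lt_neqAle; apply/andP; split; first by apply/eqP => E; apply: np.
  by apply/contained_embeds; exists g.
(* The positions kept in [q]: all those outside [I], and a copy of [psi] inside [I]. *)
pose A := (~: I :|: [set g (h i) | i in 'I_(len psi)])%SET.
have [q [lq [e [eE eA]]]] := pattern_exists A.
have cardI : #|I| = len phi by rewrite gI card_imset ?card_ord //; apply: embeds_inj.
have cardA : #|A| = len p - len phi + len psi.
  rewrite cardsU; have -> : (~: I :&: [set g (h i) | i in 'I_(len psi)] = finset.set0)%SET.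
    apply/setP => x; rewrite !inE; apply/negP => /andP[xI /imsetP[i _ xE]].
    by rewrite xE gIin in xI.
  rewrite cards0 subn0 cardsCs finset.setCK card_ord cardI card_imset ?card_ord //.
  exact: embeds_inj (embeds_comp gE hE).
have lt_phi_p := lt_len phi_p.
have lt_psi_phi := lt_len psi_phi.
have q_lt_p : (q < p)%O.
  rewrite lt_neqAle; apply/andP; split; last by apply/contained_embeds; exists e.
  apply: contraTneq lt_psi_phi => qp; move: lq; rewrite qp cardA => lE.
  rewrite -leqNgt -(leq_add2l (len p - len phi)) -lE subnK //.
  exact: ltnW.
(* At least one position lies outside [I], and [psi] is not empty. *)
have lq2 : 1 < len q.
  rewrite lq cardA; apply: (leq_add (m1 := 1) (m2 := 1)) => //.
  by rewrite subn_gt0.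
have lt1q : (unit_perm < q)%O.
  rewrite lt_neqAle unit_le ?andbT; last exact: ltnW.
  by apply: contraTneq lq2 => <-.
apply: (mobius_eq0 lt1q q_lt_p) => t _ tp ntq.
have [f fE] : exists f : 'I_(len t) -> 'I_(len p), embeds f.
  by apply/contained_embeds; apply: (ltW tp).
have [s [ls [r [rE rJ]]]] := pattern_exists (f @^-1: I)%SET.
have frI j : f (r j) \in I.
  have : r j \in (f @^-1: I)%SET by rewrite rJ imset_f.
  by rewrite inE.
have s_phi : (s <= phi)%O.
  apply: (embeds_factor (embeds_comp fE rE) gE) => i.
  by have /= := frI i; rewrite {1}gI => /imsetP[j _ ->]; exists j.
(* Otherwise the part of [t] inside [I] could be rerouted through the copy of [psi], so that [t]
   would embed into [A], that is, into [q]. *)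
have ns_psi : ~~ (s <= psi)%O.
  apply: contra ntq => /contained_embeds[u uE].
  have kE := embeds_comp gE (embeds_comp hE uE).
  have [|f' [f'E f'A]] := embeds_reroute intI fE rE kE rJ.
    by move=> j; apply: gIin.
  apply: (embeds_factor f'E eE) => i.
  have : f' i \in A.
    rewrite !inE; case: (f'A i) => [->//|[j ->]].
    by apply/orP; right; apply/imsetP; exists (u j).
  by rewrite eA => /imsetP[j _ ->]; exists j.
(* The empty pattern embeds into [psi]; this excludes a [t] that misses [I]. *)
have s0 : nonempty_perm s.
  rewrite /nonempty_perm lt0n; apply: contra ns_psi => /eqP s0.
  have noI (i : 'I_(len s)) : False by have := ltn_ord i; rewrite [in X in _ < X]s0.
  apply/contained_embeds; exists (fun i => False_rect _ (noI i)).
  by split=> i; case: (noI i).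
have st : has_interval_copy s t.
  apply/existsP; exists (f @^-1: I)%SET; apply/andP; split.
    by apply: (preim_interval fE intI (frI (Ordinal s0))).
  by apply/order_iso_at_embeds; exists r.
have [sphi|nsphi] := eqVneq s phi; first by apply: IH => //; rewrite -sphi.
have [|_ ->//] := core_SZ s0 _ ns_psi.
by rewrite lt_neqAle nsphi.
Qed.

End Core.

Theorem theorem5 (phi : permutation) (hphi : nice phi) :
  (forall p : permutation, has_interval_copy phi p -> mobius unit_perm p = 0%R) /\
  SZ phi.
Proof.
have [phi0 [psi core]] := hphi.
have all0 p : has_interval_copy phi p -> mobius unit_perm p = 0%R.
  have [n] := ubnP (len p); elim: n p => // n IH p; rewrite ltnS => pn phip.
  (* For [p = phi] the claim is the first half of niceness. *)
  have [->//|/eqP np] := eqVneq p phi.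
  apply: (core_interval core np phip) => t tp; apply: IH.
  exact: leq_trans (lt_len tp) pn.
split=> //; split=> //; case: core => -[_ /lt_len lt _] _.
exact: leq_ltn_trans (leq0n _) lt.
Qed.
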